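(* The approximation ratio of any reasonable iterative bundle minimizing algorithm for the single-minded multi-unit combinatorial auction problem cannot be better than $\frac43$; that is, for every such algorithm and every $\delta>0$ there is an instance (with all item multiplicities equal and all values equal to 1) on which the ratio between the optimal value and the value of the algorithm's output is at least $\frac43-\delta$.
   Context: Single-minded multi-unit combinatorial auction problem: the input is a set $U$ of $m$ non-identical items, each item $u$ having a positive integer multiplicity $c_u$, and a set $\mathcal{R}$ of requests, each $r$ given by a bundle $U_r\subseteq U$ and a value $v_r>0$. A feasible solution (valid multi-unit allocation) is a subset $S\subseteq\mathcal{R}$ such that every item $u$ belongs to at most $c_u$ of the bundles $U_r$, $r\in S$; its value is $\sum_{r\in S}v_r$. Let $S=\{U_r: r\in\mathcal{R}\}$. A function $g:S\to\mathbb{R}$ (which may depend on the current partial allocation) is reasonable if, whenever all item multiplicities are identical and every request has value 1, then for any valid multi-unit allocation and any two bundles $T,T'\in S$ such that $T$ has $k$ items, $T'$ has $k'$ items, $k\le k'$, and $f_i\le f'_i$ for all $1\le i\le k$, where $(f_1,\dots,f_k)$ and $(f'_1,\dots,f'_{k'})$ are the non-increasingly sorted vectors of the numbers of allocated copies of the items of $T$ and $T'$ in that allocation, we have $g(T)\le g(T')$. A reasonable iterative bundle minimizing algorithm is one that iteratively selects a bundle minimizing a reasonable function over all bundles corresponding to not-yet-selected requests. *)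

(* Defs.v *)
From HB Require Import structures.
From mathcomp Require Import all_boot all_order all_algebra.
From mathcomp Require Import reals.

Set Implicit Arguments.
Unset Strict Implicit.
Unset Printing Implicit Defensive.

Import Order.TTheory GRing.Theory Num.Theory.
Local Open Scope ring_scope.

Record instance (R : realType) := Instance {
  item : finType;
  request : finType;
  mult : item -> nat;
  bundle : request -> {set item};
  reqval : request -> R;
  mult_gt0 : forall u, (0 < mult u)%N;
  reqval_gt0 : forall r, 0 < reqval r }.

Arguments item {R} _.
Arguments request {R} _.
Arguments mult {R} {i} _.
Arguments bundle {R} {i} _.
Arguments reqval {R} {i} _.

Section Auction.
Variables (R : realType) (I : instance R).
Implicit Types (P Q : {set request I}) (T : {set item I}) (u : item I).

Definition allocated P u : nat := #|[set r in P | u \in bundle r]|.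

Definition valid_allocation P : bool := [forall u, (allocated P u <= mult u)%N].

Definition alloc_value P : R := \sum_(r in P) reqval r.

(* The default 0 of the maximum is the value of the empty allocation, which is
   valid, so this is a maximum over a nonempty set of nonnegative values. *)
Definition opt_value : R :=
  \big[Num.max/0]_(P : {set request I} | valid_allocation P) alloc_value P.

Definition bundles : {set {set item I}} := [set bundle r | r : request I].

Definition sorted_alloc P T : seq nat :=
  sort geq [seq allocated P u | u <- enum T].

Definition uniform_mult : Prop := forall u u', mult u = mult u'.

Definition unit_values : Prop := forall r : request I, reqval r = 1.

Definition add_if_valid P (r : request I) : {set request I} :=
  if valid_allocation (r |: P) then r |: P else P.

End Auction.

Arguments opt_value {R} I.
Arguments bundles {R} I.
Arguments uniform_mult {R} I.
Arguments unit_values {R} I.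

(* [g I P T]: the score of the bundle T in the instance I when the current
   partial allocation is P. Only its values at T in [bundles I] are ever used. *)
Definition bundle_function (R : realType) : Type :=
  forall I : instance R, {set request I} -> {set item I} -> R.

Definition reasonable (R : realType) (g : bundle_function R) : Prop :=
  forall I : instance R, uniform_mult I -> unit_values I ->
  forall P : {set request I}, valid_allocation P ->
  forall T T' : {set item I}, T \in bundles I -> T' \in bundles I ->
    (#|T| <= #|T'|)%N ->
    (forall i : nat, (i < #|T|)%N ->
       (nth 0%N (sorted_alloc P T) i <= nth 0%N (sorted_alloc P T') i)%N) ->
    g I P T <= g I P T'.

Definition minimizes (R : realType) (g : bundle_function R) (I : instance R)
    (Q P : {set request I}) (r : request I) : Prop :=
  r \notin Q /\
  forall r' : request I, r' \notin Q -> g I P (bundle r) <= g I P (bundle r').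

(* [reachable g Q P]: after some number of iterations, the requests selected so
   far are Q and the current allocation is P. A selected request whose bundle no
   longer fits is discarded, so P may be a proper subset of Q. Ties between
   minimizers are left open, hence a relation: a performance guarantee has to hold
   for every output. (A constant g is reasonable, so a tie-breaking rule chosen at
   will could make the algorithm optimal.) *)
Inductive reachable (R : realType) (g : bundle_function R) (I : instance R) :
    {set request I} -> {set request I} -> Prop :=
| reachable_start : reachable g set0 set0
| reachable_step (Q P : {set request I}) (r : request I) :
    reachable g Q P -> minimizes g Q P r ->
    reachable g (r |: Q) (add_if_valid P r).

(* A possible output of the iterative minimizing algorithm driven by g, once
   every request has been selected. *)
Definition algorithm_output (R : realType) (g : bundle_function R)
    (I : instance R) (P : {set request I}) : Prop :=
  reachable g [set: request I] P.

(* Main.v *)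
(** Take the four items of a 2 x 2 grid, one copy each, and request the two rows
and one column. The empty allocation loads every item by 0, so a reasonable
function ties on these three bundles of two items, and the algorithm may select
the column first. The column meets both rows, which are then rejected: the output
has value 1, whereas the two rows together have value 2. *)

Require Import Defs.
From HB Require Import structures.
From mathcomp Require Import all_boot all_order all_algebra.
From mathcomp Require Import reals.
From mathcomp Require Import lra.

Import Order.TTheory GRing.Theory Num.Theory.
Local Open Scope ring_scope.

Lemma minimizes_exists (R : realType) (g : bundle_function R) (I : instance R)
    (Q P : {set request I}) :
  Q != setT -> exists r, minimizes g Q P r.
Proof.
rewrite -subTset => /subsetPn[r0 _ r0Q].
have [r rQ r_min] := arg_minP (P := [pred r | r \notin Q]) (fun r => g I P (bundle r)) r0Q.
by exists r.
Qed.

(** Once every unselected request is blocked, each further iteration discards its request and leaves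
    [P] unchanged. A minimizer exists as long as some request is unselected, so the run can be
    completed; the induction is on the number of unselected requests. *)
Lemma maximal_reachable_output (R : realType) (g : bundle_function R)
    (I : instance R) (Q P : {set request I}) :
  reachable g Q P ->
  (forall r, r \notin Q -> ~~ valid_allocation (r |: P)) ->
  algorithm_output g P.
Proof.
have [n] := ubnP #|~: Q|; elim: n Q => // n IHn Q le_n QP blocked.
have [QT|QT] := eqVneq Q setT; first by rewrite /algorithm_output -QT.
have [r min_r] := minimizes_exists R g I Q P QT.
have rQ := min_r.1.
apply: (IHn (r |: Q)).
- rewrite -ltnS; apply: leq_trans le_n; rewrite ltnS; apply: proper_card.
  by rewrite properC properUr // sub1set.
- by have := reachable_step QP min_r; rewrite /add_if_valid (negbTE (blocked r rQ)).
- by move=> r'; rewrite in_setU1 negb_or => /andP[_ /blocked].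
Qed.

Lemma allocated_set0 (R : realType) (I : instance R) (u : item I) :
  allocated set0 u = 0%N.
Proof. by apply/eqP; rewrite cards_eq0; apply/eqP/setP => r; rewrite !inE. Qed.

Lemma sorted_alloc_set0 (R : realType) (I : instance R) (T : {set item I}) :
  sorted_alloc set0 T = nseq #|T| 0%N.
Proof.
rewrite /sorted_alloc (eq_map (allocated_set0 R I)) cardE.
set s := sort _ _; have <- : size s = size (enum T) by rewrite size_sort size_map.
(* A sequence with only zero entries is determined by its size, so the sort need not be computed. *)
by apply/all_pred1P; rewrite all_sort; apply/allP => _ /mapP[u _ ->] /=.
Qed.

(** Before anything is allocated both sorted vectors are zero, so only the bundle sizes matter;
    bundles of equal size therefore tie. *)
Lemma reasonable_set0_le (R : realType) (g : bundle_function R) (I : instance R)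
    (r r' : request I) :
  reasonable g -> uniform_mult I -> unit_values I ->
  (#|bundle r| <= #|bundle r'|)%N ->
  g I set0 (bundle r) <= g I set0 (bundle r').
Proof.
move=> hg uI vI le_rr'; apply: hg => //; try exact: imset_f.
  by apply/forallP => u; rewrite allocated_set0.
by move=> i _; rewrite !sorted_alloc_set0 !nth_nseq !if_same.
Qed.

(** [Some b] requests the row with first coordinate [b]; [None] requests the column with second
    coordinate [true]. *)
Definition grid_bundle (r : option bool) : {set bool * bool} :=
  if r is Some b then setX [set b] setT else setX setT [set true].

Definition grid (R : realType) : instance R :=
  @Instance R (bool * bool)%type (option bool) (fun=> 1%N) grid_bundle (fun=> 1)
    (fun=> isT) (fun=> ltr01).

Definition column (R : realType) : {set request (grid R)} := [set None].

Definition rows (R : realType) : {set request (grid R)} := [set~ None].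

Lemma card_grid_bundle (R : realType) (r : request (grid R)) : #|bundle r| = 2.
Proof. by case: r => [b|]; rewrite /= cardsX cards1 cardsT card_bool. Qed.

Lemma column_valid (R : realType) : valid_allocation (column R).
Proof.
apply/forallP => u; rewrite /= /allocated -(cards1 (None : request (grid R))).
by apply: subset_leq_card; apply/subsetP => r; rewrite inE => /andP[].
Qed.

Lemma column_blocks (R : realType) (r : request (grid R)) :
  r \notin column R -> ~~ valid_allocation (r |: column R).
Proof.
case: r => [b _|]; last by rewrite !inE eqxx.
(* Row [b] crosses the column at this item, whose single copy would be used twice. *)
apply/forallPn; exists (b, true); rewrite /= -ltnNge /allocated.
apply: (@leq_trans #|[set Some b; None]|); first by rewrite cards2.
apply: subset_leq_card; apply/subsetP => r; rewrite !inE.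
by case/orP => /eqP ->; rewrite /= !inE ?eqxx.
Qed.

Lemma rows_valid (R : realType) : valid_allocation (rows R).
Proof.
(* The only row through [u] is the one indexed by its first coordinate. *)
apply/forallP => u; rewrite /= /allocated -(cards1 (Some u.1)).
apply: subset_leq_card; apply/subsetP => -[b|]; rewrite !inE //=.
by rewrite andbT => /eqP ->.
Qed.

Lemma column_output (R : realType) (g : bundle_function R) :
  reasonable g -> algorithm_output g (column R).
Proof.
move=> hg; apply: (maximal_reachable_output _ _ _ (column R)); last first.
  exact: column_blocks.
have min_col : minimizes g set0 set0 (None : request (grid R)).
  split=> [|r _]; first by rewrite inE.
  by apply: reasonable_set0_le => //; rewrite !card_grid_bundle.
have := reachable_step (reachable_start g (grid R)) min_col.
by rewrite /add_if_valid setU0 column_valid.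
Qed.

Lemma opt_value_grid_ge2 (R : realType) : 2 <= opt_value (grid R).
Proof.
apply: le_trans (le_bigmax_cond _ _ (rows_valid R)).
by rewrite /alloc_value sumr_const cardsC1 card_option card_bool.
Qed.

Theorem theorem6 (R : realType) (g : bundle_function R) (hg : reasonable g)
    (delta : R) (hdelta : 0 < delta) :
  exists I : instance R,
    [/\ uniform_mult I, unit_values I &
        exists P : {set request I},
          algorithm_output g P /\
          4 / 3 - delta <= opt_value I / alloc_value P].
Proof.
exists (grid R); split=> //; exists (column R); split; first exact: column_output.
rewrite /alloc_value big_set1 /= divr1.
(* The output has value 1, so the ratio is at least 2, which exceeds [4 / 3]. *)
by have := opt_value_grid_ge2 R; lra.
Qed.
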